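(* Let $n \ge 1$, let $F$ be a smooth fibration of the unit sphere $S^{2n+1} \subset \mathbb{R}^{2n+2}$ by oriented great circles, let $V$ be the unit vector field on $S^{2n+1}$ tangent to the fibres of $F$ and pointing in the direction of their orientation, and let $\xi_F = \{V_x^{\perp} : x \in S^{2n+1}\}$ be the distribution of tangent $2n$-planes orthogonal to these fibres. For each $x \in S^{2n+1}$ let $T_x : V_x^{\perp} \to V_x^{\perp}$, $T_x(B) = \nabla_B V$, be the twisting map. Then $\xi_F$ is a contact structure on $S^{2n+1}$ if and only if the skew-symmetrization $T_x - T_x^{tr} : V_x^{\perp} \to V_x^{\perp}$ is nonsingular at each point $x \in S^{2n+1}$.
   Context: $S^{2n+1}$ is the unit sphere centered at the origin of $\mathbb{R}^{2n+2}$ with its round metric $\langle\cdot,\cdot\rangle$ and Levi-Civita connection $\nabla$. A smooth fibration of $S^{2n+1}$ by oriented great circles is a smooth fibre bundle with total space $S^{2n+1}$ whose fibres are great circles (intersections of $S^{2n+1}$ with 2-dimensional linear subspaces of $\mathbb{R}^{2n+2}$), oriented consistently so that the unit tangent field $V$ is smooth. For $x \in S^{2n+1}$, $V_x$ is the value of $V$ at $x$ and $V_x^{\perp} \subset T_xS^{2n+1}$ is the tangent $2n$-plane orthogonal to $V_x$. For $B \in V_x^{\perp}$, the covariant derivative $\nabla_B V$ lies in $V_x^{\perp}$ because $\langle V, V\rangle = 1$; so $T_x$ is a well-defined linear map of $V_x^{\perp}$ to itself. $T_x^{tr}$ denotes the transpose (adjoint) of $T_x$ with respect to the inner product on $V_x^{\perp}$.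 Let $\alpha$ be the one-form on $S^{2n+1}$ given by $\alpha(W) = \langle V, W\rangle$, so that $\xi_F = \ker\alpha$. By definition, $\xi_F$ is a contact structure if and only if $\alpha \wedge (d\alpha)^n \neq 0$ at each point of $S^{2n+1}$. *)

(* Defs.v *)
From mathcomp Require Export all_boot all_order all_algebra all_fingroup.
From mathcomp Require Export all_classical all_reals all_analysis.
Export Order.TTheory GRing.Theory Num.Theory.
Export numFieldNormedType.Exports.

Set Implicit Arguments.
Unset Strict Implicit.
Unset Printing Implicit Defensive.

Open Scope classical_set_scope.
Open Scope ring_scope.

(** * The unit sphere as a submanifold of Euclidean space *)

(* The library norm on ['rV[R]_m] is the sup norm; it is used here only for
   its topology.  All metric notions go through [dot]. *)
Definition dot (R : realType) (m : nat) (u v : 'rV[R]_m) : R :=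
  \sum_(i < m) u 0 i * v 0 i.

Definition sphere (R : realType) (m : nat) : set 'rV[R]_m :=
  [set x | dot x x = 1].
Arguments sphere R m : clear implicits.

Definition normalize (R : realType) (m : nat) (x : 'rV[R]_m) : 'rV[R]_m :=
  (Num.sqrt (dot x x))^-1 *: x.

Definition orthov (R : realType) (m : nat) (u : 'rV[R]_m) : {vspace 'rV[R]_m} :=
  lker (linfun (dot u : 'rV[R]_m -> R^o)).

(* T_x S for [x] on the sphere, as a subspace of the ambient space; the round
   metric is the restriction of [dot] to it. *)
Definition tangent (R : realType) (m : nat) (x : 'rV[R]_m) :
  {vspace 'rV[R]_m} := orthov x.

(** * Smoothness *)

(* For finite-dimensional [E]: C^(k+1) on the open set [U] iff differentiable
   there with all directional derivatives C^k. *)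
Fixpoint Ck (R : realType) (E F : normedModType R) (k : nat)
    (U : set E) (f : E -> F) : Prop :=
  if k is k'.+1 then
    (forall x, U x -> differentiable f x) /\
    (forall v : E, Ck k' U (fun x => 'D_v f x))
  else forall x, U x -> {for x, continuous f}.

(* Smoothness of a map on an arbitrary subset [A]: local existence of smooth
   extensions to open sets of [E].  Only the values of [f] on [A] matter. *)
Definition smooth_on (R : realType) (E F : normedModType R)
    (A : set E) (f : E -> F) : Prop :=
  forall x, A x -> exists (U : set E) (g : E -> F),
    [/\ open U, U x, (forall k, Ck k U g)
      & forall y, U y -> A y -> g y = f y].

(** * Smooth manifolds and smooth circle bundles over them *)

Record chart (R : realType) (d : nat) (M : topologicalType) := Chart {
  cdom : set M;
  cmap : M -> 'rV[R]_d;
  cinv : 'rV[R]_d -> M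
}.

Definition ctarget (R : realType) (d : nat) (M : topologicalType)
  (c : chart R d M) : set 'rV[R]_d := cmap c @` cdom c.

Record is_chart (R : realType) (d : nat) (M : topologicalType)
    (c : chart R d M) : Prop := IsChart {
  cdom_open : open (cdom c);
  ctarget_open : open (ctarget c);
  cmapK : forall b, cdom c b -> cinv c (cmap c b) = b;
  cmap_cont : {within cdom c, continuous (cmap c)};
  cinv_cont : {within ctarget c, continuous (cinv c)}
}.

Record smooth_manifold (R : realType) (d : nat) (M : topologicalType)
    (A : set (chart R d M)) : Prop := SmoothManifold {
  sm_hausdorff : hausdorff_space M;
  sm_second_countable : @second_countable M;
  sm_charts : forall c, A c -> is_chart c;
  sm_cover : forall b, exists2 c, A c & cdom c b;
  sm_transition : forall c c', A c -> A c' ->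
    smooth_on (ctarget c `&` cinv c @^-1` cdom c') (cmap c' \o cinv c)
}.

(* Over the open set [U], [x |-> (p x, theta x)] is a diffeomorphism from
   [S `&` p @^-1` U] onto [U * S^1] with inverse [psi]; [p] itself is required
   to be smooth in [smooth_circle_bundle]. *)
Record local_trivialization (R : realType) (m d : nat) (M : topologicalType)
    (A : set (chart R d M)) (p : 'rV[R]_m -> M) (U : set M)
    (theta : 'rV[R]_m -> 'rV[R]_2) (psi : M -> 'rV[R]_2 -> 'rV[R]_m) : Prop :=
  LocalTrivialization {
  lt_open : open U;
  lt_theta_circle : forall x, sphere R m x -> U (p x) -> sphere R 2 (theta x);
  lt_psiK : forall x, sphere R m x -> U (p x) -> psi (p x) (theta x) = x;
  lt_psi : forall b s, U b -> sphere R 2 s ->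
    [/\ sphere R m (psi b s), p (psi b s) = b & theta (psi b s) = s];
  lt_theta_smooth : smooth_on (sphere R m `&` p @^-1` U) theta;
  lt_psi_smooth : forall c, A c ->
    smooth_on [set zs : 'rV[R]_d * 'rV[R]_2 |
                 [/\ ctarget c zs.1, U (cinv c zs.1) & sphere R 2 zs.2]]
              (fun zs => psi (cinv c zs.1) zs.2)
}.

(* Smooth fibre bundle with total space the sphere, projection [p] (whose values
   off the sphere are irrelevant), fibre S^1, base [M] with atlas [A]. *)
Record smooth_circle_bundle (R : realType) (m d : nat) (M : topologicalType)
    (A : set (chart R d M)) (p : 'rV[R]_m -> M) : Prop := SmoothCircleBundle {
  scb_base : smooth_manifold A;
  scb_cont : {within sphere R m, continuous p};
  scb_smooth : forall c, A c ->
    smooth_on (sphere R m `&` p @^-1` cdom c) (cmap c \o p);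
  scb_trivial : forall b, exists U theta psi,
    U b /\ local_trivialization A p U theta psi
}.

(** * Vector fields and oriented fibrations by great circles *)

Definition vector_field (R : realType) (m : nat) (X : 'rV[R]_m -> 'rV[R]_m) :
  Prop :=
  smooth_on (sphere R m) X /\ forall x, sphere R m x -> X x \in tangent x.

Definition great_circle (R : realType) (m : nat) (P : {vspace 'rV[R]_m}) :
  set 'rV[R]_m := sphere R m `&` [set x | x \in P].

(* The orientation of the fibres is given by their unit tangent field [V]; the
   tangent line at [x] of the great circle cut out by [P] is the intersection of
   [P] with [tangent x]. *)
Record oriented_great_circle_fibration (R : realType) (m d : nat)
    (M : topologicalType) (A : set (chart R d M)) (p : 'rV[R]_m -> M)
    (V : 'rV[R]_m -> 'rV[R]_m) : Prop := OrientedGreatCircleFibration {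
  ogf_bundle : smooth_circle_bundle A p;
  ogf_circles : forall b, exists P : {vspace 'rV[R]_m},
    \dim P = 2%N /\ sphere R m `&` p @^-1` [set b] = great_circle P;
  ogf_field : vector_field V;
  ogf_unit : forall x, sphere R m x -> dot (V x) (V x) = 1;
  ogf_tangent : forall x (P : {vspace 'rV[R]_m}), sphere R m x ->
    \dim P = 2%N -> sphere R m `&` p @^-1` [set p x] = great_circle P ->
    V x \in P
}.

(** * The Levi-Civita connection of the round metric *)

(* Derivative at [x] on the sphere, along [B] tangent at [x], of a map defined
   on the sphere, computed on its radial extension. *)
Definition sderive (R : realType) (m : nat) (F : normedModType R)
    (f : 'rV[R]_m -> F) (x B : 'rV[R]_m) : F :=
  'D_B (f \o @normalize R m) x.

Definition lie_bracket (R : realType) (m : nat) (X Y : 'rV[R]_m -> 'rV[R]_m)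
    (x : 'rV[R]_m) : 'rV[R]_m :=
  sderive Y x (X x) - sderive X x (Y x).

(* [nabla Y x B] stands for nabla_B Y at [x], for [B] tangent at [x]. *)
Record levi_civita (R : realType) (m : nat)
    (nabla : ('rV[R]_m -> 'rV[R]_m) -> 'rV[R]_m -> 'rV[R]_m -> 'rV[R]_m) :
    Prop := LeviCivita {
  lc_linear : forall Y x a B C, vector_field Y -> sphere R m x ->
    B \in tangent x -> C \in tangent x ->
    nabla Y x (a *: B + C) = a *: nabla Y x B + nabla Y x C;
  lc_smooth : forall X Y, vector_field X -> vector_field Y ->
    vector_field (fun x => nabla Y x (X x));
  lc_add : forall Y Z x B, vector_field Y -> vector_field Z ->
    sphere R m x -> B \in tangent x ->
    nabla (fun y => Y y + Z y) x B = nabla Y x B + nabla Z x B;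
  lc_leibniz : forall (f : 'rV[R]_m -> R^o) Y x B,
    smooth_on (sphere R m) f -> vector_field Y ->
    sphere R m x -> B \in tangent x ->
    nabla (fun y => f y *: Y y) x B = sderive f x B *: Y x + f x *: nabla Y x B;
  lc_metric : forall Y Z x B, vector_field Y -> vector_field Z ->
    sphere R m x -> B \in tangent x ->
    sderive (fun y => dot (Y y) (Z y) : R^o) x B =
      dot (nabla Y x B) (Z x) + dot (Y x) (nabla Z x B);
  lc_torsion_free : forall X Y x, vector_field X -> vector_field Y ->
    sphere R m x ->
    nabla Y x (X x) - nabla X x (Y x) = lie_bracket X Y x
}.

(** * The twisting map *)

(* The 2n-plane V_x^perp inside T_x S. *)
Definition perp (R : realType) (m : nat) (V : 'rV[R]_m -> 'rV[R]_m)
    (x : 'rV[R]_m) : {vspace 'rV[R]_m} := (tangent x :&: orthov (V x))%VS.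

(* [vsproj] is the identity on V_x^perp, and nabla_B V lies there. *)
Definition twisting (R : realType) (m : nat)
    (nabla : ('rV[R]_m -> 'rV[R]_m) -> 'rV[R]_m -> 'rV[R]_m -> 'rV[R]_m)
    (V : 'rV[R]_m -> 'rV[R]_m) (x : 'rV[R]_m) : 'End(subvs_of (perp V x)) :=
  linfun (fun B : subvs_of (perp V x) =>
            vsproj (perp V x) (nabla V x (vsval B))).

(* The adjoint for the restriction of [dot] to [W], by unique description. *)
Definition transpose (R : realType) (m : nat) (W : {vspace 'rV[R]_m})
    (T : 'End(subvs_of W)) : 'End(subvs_of W) :=
  xget 0 [set T' : 'End(subvs_of W) | forall B C : subvs_of W,
            dot (vsval (T B)) (vsval C) = dot (vsval B) (vsval (T' C))].

(** * Exterior algebra and contact structures *)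

(* Alternating [k]-forms at a point, as functions of [k] ambient vectors. *)
Definition form (R : realType) (m k : nat) := ('I_k -> 'rV[R]_m) -> R.

Definition wedge (R : realType) (m k l : nat)
    (a : form R m k) (b : form R m l) : form R m (k + l) :=
  fun v => (k`! * l`!)%:R^-1 *
    \sum_(s : 'S_(k + l)) (-1) ^+ s *
       a (fun i => v (s (lshift l i))) * b (fun j => v (s (rshift k j))).

Fixpoint wedge_pow (R : realType) (m k : nat) (a : form R m k) (j : nat) :
    form R m (j * k) :=
  if j is j'.+1 then wedge a (@wedge_pow R m k a j') else fun=> 1.
Arguments wedge_pow {R m k} a j.

(* The one-form alpha(W) = <V, W>; its kernel on T_x S is [perp V x]. *)
Definition alpha (R : realType) (m : nat) (V : 'rV[R]_m -> 'rV[R]_m)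
    (x W : 'rV[R]_m) : R := dot (V x) W.

(* For [X], [Y] tangent at [x], the exterior derivative at [x] of the one-form
   that [a] induces on the sphere, [a x] being linear on the ambient space: by
   naturality it is the restriction to T_x S of the exterior derivative of the
   ambient one-form [a \o normalize], evaluated on the constant (hence
   commuting) vector fields [X] and [Y]. *)
Definition dform1 (R : realType) (m : nat) (a : 'rV[R]_m -> 'rV[R]_m -> R)
    (x X Y : 'rV[R]_m) : R :=
  sderive (fun y => a y Y : R^o) x X - sderive (fun y => a y X : R^o) x Y.

Definition alpha_dalpha (R : realType) (m n : nat)
    (V : 'rV[R]_m -> 'rV[R]_m) (x : 'rV[R]_m) : form R m (1 + n * 2) :=
  wedge ((fun v => alpha V x (v ord0)) : form R m 1)
    (wedge_pow
       ((fun v => dform1 (alpha V) x (v ord0) (v ord_max)) : form R m 2) n).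
Arguments alpha_dalpha {R m} n V x v.

(* The hyperplane distribution V^perp = ker alpha on the (2n+1)-sphere is a
   contact structure: alpha /\ (d alpha)^n is, at each point [x], nonzero as a
   form on T_x S. *)
Definition contact_structure (R : realType) (n : nat)
    (V : 'rV[R]_(2 * n).+2 -> 'rV[R]_(2 * n).+2) : Prop :=
  forall x, sphere R (2 * n).+2 x ->
    exists v : 'I_(1 + n * 2) -> 'rV[R]_(2 * n).+2,
      (forall i, v i \in tangent x) /\ alpha_dalpha n V x v != 0.

(* Main.v *)
From HB Require Import structures.
Require Import Defs.

(** The proof is pointwise. At a point [x] of the sphere let alpha be the form
    <V, .> and omega its exterior derivative, and write W for the kernel
    of alpha in the tangent space, that is, for the plane orthogonal to [V
    x].

    For a torsion-free metric connection, omega(B, C) = <nabla_B V, C> -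
    <nabla_C V, B> for tangent vectors B and C ([dform1_alphaE]). As
    nabla_B V stays in W ([nabla_perp]), for B and C in W this says that
    omega(B, C) = <(T - T^tr) B, C>, where T is the twisting map. Since
    the metric is definite, T - T^tr is nonsingular if and only if omega
    is nondegenerate on W ([skew_twisting_nondegenerate]).

    The rest is linear algebra in a space of dimension 2n + 1: alpha wedge
    omega^n is nonzero if and only if omega is nondegenerate on the kernel
    of alpha ([altsum_neq0_iff_nondegenerate]). Up to nonzero constants,
    iterated wedge products are alternating sums of tensor powers
    ([wedge_altsum], [wedge_powE]). If some nonzero u in W pairs to zero
    with all of W, complete u to a basis of W and add a vector outside W;
    evaluated on this basis, every term of the alternating sum contains
    the value of omega at u and some element of W, or the value of alpha
    at an element of W ([altsum_degenerate]). If omega is nondegenerate on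
    W, arguments on which omega^n does not vanish are built two at a time:
    a vector u of W orthogonal for omega to the arguments already chosen,
    and a vector that pairs nontrivially with u
    ([altsum_tensor_pow_neq0]). The contraction formula [altsum_contract]
    computes the new value from the old one; it rests on the fact that all
    the positions in a tensor power of omega are equivalent. *)

Set Implicit Arguments.
Unset Strict Implicit.
Unset Printing Implicit Defensive.

(** * Alternating sums of tensor powers *)

Lemma ord2_cases (i : 'I_2) : i = ord0 \/ i = ord_max.
Proof. by case: i => -[|[]] // p; [left | right]; apply: val_inj. Qed.

Section BlockPerm.

(** The permutation of the last [l] indices of ['I_(k + l)] that acts as [t],
    as an iterated [lift_perm], so that its parity is that of [t]. *)
Fixpoint shift_perm k l (t : 'S_l) : 'S_(k + l) :=
  if k is k'.+1 then lift_perm ord0 ord0 (shift_perm k' t) else t.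

Lemma lshift0S k l : lshift l (ord0 : 'I_k.+1) = ord0 :> 'I_(k + l).+1.
Proof. exact: val_inj. Qed.

Lemma lshiftS k l (i : 'I_k) :
  lshift l (lift ord0 i) = lift ord0 (lshift l i) :> 'I_(k + l).+1.
Proof. exact: val_inj. Qed.

Lemma rshiftS k l (j : 'I_l) :
  rshift k.+1 j = lift ord0 (rshift k j) :> 'I_(k + l).+1.
Proof. exact: val_inj. Qed.

Lemma shift_perm_lshift k l (t : 'S_l) i :
  shift_perm k t (lshift l i) = lshift l i.
Proof.
elim: k i => [[]//|k IH] i /=; case: (unliftP ord0 i) => [i'|] ->.
  by rewrite lshiftS lift_perm_lift IH.
by rewrite lshift0S lift_perm_id.
Qed.

Lemma shift_perm_rshift k l (t : 'S_l) j :
  shift_perm k t (rshift k j) = rshift k (t j).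
Proof.
elim: k => [|k IH] /=.
  by rewrite !(_ : forall i, rshift 0 i = i) // => i; apply: val_inj.
by rewrite !rshiftS lift_perm_lift IH.
Qed.

Lemma odd_shift_perm k l (t : 'S_l) : shift_perm k t = t :> bool.
Proof. by elim: k => //= k IH; rewrite odd_lift_perm IH. Qed.

Lemma lift_perm_surj n (s : 'S_n.+1) :
  s ord0 = ord0 -> exists t, s = lift_perm ord0 ord0 t.
Proof.
move=> s0; pose g k := odflt k (unlift ord0 (s (lift ord0 k))).
have gE k : lift ord0 (g k) = s (lift ord0 k).
  rewrite /g; case: unliftP => [j ->//|]; rewrite -[RHS]s0 => /perm_inj/eqP.
  by rewrite eq_sym (negPf (neq_lift _ _)).
have g_inj : injective g.
  by move=> a b ab; apply/(@lift_inj _ ord0)/(@perm_inj _ s); rewrite -!gE ab.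
exists (perm g_inj); apply/permP => i; case: (unliftP ord0 i) => [j|] ->.
  by rewrite lift_perm_lift permE gE.
by rewrite lift_perm_id.
Qed.

Lemma shift_perm_surj k l (s : 'S_(k + l)) :
  (forall i, s (lshift l i) = lshift l i) -> exists t, s = shift_perm k t.
Proof.
elim: k s => [|k IH] s fix_s; first by exists s.
have [s1 s1E] := lift_perm_surj (etrans (esym (congr1 s (lshift0S k l)))
   (etrans (fix_s ord0) (lshift0S k l))).
have [i|t tE] := IH s1; last by exists t; rewrite /= -tE.
apply: (@lift_inj _ ord0); rewrite -(lift_perm_lift ord0) -s1E -!lshiftS.
exact: fix_s.
Qed.

Lemma shift_perm_inj k l : injective (@shift_perm k l).
Proof.
move=> t t' tt'; apply/permP => j; apply: (@rshift_inj k).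
by rewrite -!shift_perm_rshift tt'.
Qed.

Lemma sum_shift_perm (R : nmodType) k l (F : 'S_(k + l) -> R) :
  \sum_(s : 'S_(k + l) | [forall i, s (lshift l i) == lshift l i]) F s =
  \sum_(t : 'S_l) F (shift_perm k t).
Proof.
rewrite -(big_imset _ (in2W (@shift_perm_inj k l))) /=; apply: eq_bigl => s.
apply/forallP/imsetP => [fix_s|[t _ -> i]]; last by rewrite shift_perm_lshift.
by have [t ->] := shift_perm_surj (fun i => eqP (fix_s i)); exists t.
Qed.

End BlockPerm.

Section Alternation.
Variables (R : numFieldType) (E : Type).

(** For [f] multilinear this is [N`!] times the antisymmetrization of [f];
    leaving out the factor makes it the determinant when [f] is a product
    of coordinates. *)
Definition altsum N (f : ('I_N -> E) -> R) (v : 'I_N -> E) : R :=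
  \sum_(s : 'S_N) (-1) ^+ s * f (fun i => v (s i)).

Definition tensor k l (a : ('I_k -> E) -> R) (b : ('I_l -> E) -> R)
    (v : 'I_(k + l) -> E) : R :=
  a (fun i => v (lshift l i)) * b (fun j => v (rshift k j)).

Fixpoint tensor_pow k (a : ('I_k -> E) -> R) j : ('I_(j * k) -> E) -> R :=
  if j is j'.+1 then tensor a (@tensor_pow k a j') else fun=> 1.
Arguments tensor_pow {k} a j v.

Lemma altsum_perm N (f : ('I_N -> E) -> R) v (t : 'S_N) :
  altsum f (fun i => v (t i)) = (-1) ^+ t * altsum f v.
Proof.
rewrite /altsum mulr_sumr (reindex_inj (mulIg t^-1%g)); apply: eq_bigr => s _.
rewrite mulrA -signr_addb odd_permM odd_permV addbC; congr (_ * f _).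
by apply/funext => i; rewrite permM permKV.
Qed.

Lemma altsum_eq0 N (f : ('I_N -> E) -> R) v i j :
  i != j -> v i = v j -> altsum f v = 0.
Proof.
move=> ij vij; have := altsum_perm f v (tperm i j).
rewrite odd_tperm ij expr1 mulN1r (_ : (fun k => v _) = v); last first.
  by apply/funext => k; case: tpermP => [->|->|].
by move/eqP; rewrite -addr_eq0 -mulr2n mulrn_eq0 /= => /eqP.
Qed.

(** Antisymmetrizing the second factor first changes nothing but a factor:
    each inner permutation [t] is absorbed into [s] by [s |-> shift_perm k
    t * s], which preserves signs. It turns the nested sums of an iterated
    wedge product into a single sum. *)
Lemma altsum_tensor k l (a : ('I_k -> E) -> R) (b : ('I_l -> E) -> R) v :
  \sum_(s : 'S_(k + l)) (-1) ^+ s * a (fun i => v (s (lshift l i))) *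
     altsum b (fun j => v (s (rshift k j))) =
  l`!%:R * altsum (tensor a b) v.
Proof.
under eq_bigr => s _ do rewrite /altsum mulr_sumr.
rewrite exchange_big /= -card_Sn -sum1_card natr_sum mulr_suml.
apply: eq_bigr => t _; rewrite mul1r /altsum.
rewrite [RHS](reindex_inj (mulgI (shift_perm k t))) /=; apply: eq_bigr => s _.
rewrite odd_permM odd_shift_perm signr_addb mulrACA [X in X * _]mulrC /tensor.
congr (_ * (a _ * b _)); apply/funext => i.
  by rewrite permM shift_perm_lshift.
by rewrite permM shift_perm_rshift.
Qed.

(** When only the permutations that fix the first block of indices contribute,
    what remains of the sum runs over the permutations of the second
    block. *)
Lemma sum_tensor_fixing k l (a : ('I_k -> E) -> R) (b : ('I_l -> E) -> R) v
    (P : pred 'S_(k + l)) :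
  (forall s : 'S_(k + l), [forall i, s (lshift l i) == lshift l i] -> P s) ->
  (forall s : 'S_(k + l), P s -> ~~ [forall i, s (lshift l i) == lshift l i] ->
     a (fun i => v (s (lshift l i))) = 0) ->
  \sum_(s | P s) (-1) ^+ s * tensor a b (fun i => v (s i)) =
    a (fun i => v (lshift l i)) * altsum b (fun j => v (rshift k j)).
Proof.
move=> fixP a0.
pose fix_l (s : 'S_(k + l)) := [forall i, s (lshift l i) == lshift l i].
rewrite (bigID fix_l) /= [X in _ + X]big1 ?addr0; last first.
  by move=> s /andP[Ps /(a0 s Ps) as0]; rewrite /tensor as0 mul0r mulr0.
rewrite (eq_bigl fix_l) => [|s]; last by apply/andb_idl/fixP.
rewrite sum_shift_perm mulr_sumr; apply: eq_bigr => t _.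
rewrite odd_shift_perm [RHS]mulrCA /tensor.
congr (_ * (a _ * b _)); apply/funext => i.
  by rewrite shift_perm_lshift.
by rewrite shift_perm_rshift.
Qed.

Lemma altsum0 (f : ('I_0 -> E) -> R) v : altsum f v = f v.
Proof.
rewrite /altsum (big_pred1 1%g) => [|s]; last by apply/esym/eqP/permP => -[].
by rewrite odd_perm1 mul1r; congr f; apply/funext => -[].
Qed.

(** Permutations of the arguments under which [f] itself, before any
    antisymmetrization, already behaves as an alternating form. *)
Definition sgnsym N (f : ('I_N -> E) -> R) (t : 'S_N) :=
  forall v, f (fun i => v (t i)) = (-1) ^+ t * f v.

Lemma sgnsymM N (f : ('I_N -> E) -> R) s t :
  sgnsym f s -> sgnsym f t -> sgnsym f (s * t)%g.
Proof.
move=> fs ft v; rewrite odd_permM signr_addb -mulrA -ft -fs; congr f.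
by apply/funext => i; rewrite permM.
Qed.

Lemma sgnsym_shift_perm k l (a : ('I_k -> E) -> R) (b : ('I_l -> E) -> R) t :
  sgnsym b t -> sgnsym (tensor a b) (shift_perm k t).
Proof.
move=> bt v; rewrite /tensor odd_shift_perm mulrCA -bt.
congr (a _ * b _); apply/funext => i.
  by rewrite shift_perm_lshift.
by rewrite shift_perm_rshift.
Qed.

(** If the sign symmetries of [f] carry the position [i0] to every other
    position, then all the partial sums over the permutations that send a
    given position to [i0] agree, and the one at position [i0] counts [N]
    times. *)
Lemma altsum_fix_point N (f : ('I_N -> E) -> R) v (i0 : 'I_N) :
  (forall j, exists2 t : 'S_N, t i0 = j & sgnsym f t) ->
  altsum f v =
    N%:R * \sum_(s : 'S_N | s i0 == i0) (-1) ^+ s * f (fun i => v (s i)).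
Proof.
move=> tr.
rewrite /altsum (partition_big (fun s : 'S_N => s^-1%g i0) predT) //=.
set rhs := \sum_(s | _) _.
rewrite -[X in X%:R](card_ord N) -sum1_card natr_sum mulr_suml.
apply: eq_bigr => j _; rewrite mul1r {}/rhs; have [t ti0 ft] := tr j.
rewrite [RHS](reindex_inj (mulgI t)) /=; apply: eq_big => [s|s _].
  by rewrite permM ti0 (canF_eq (permK s)) eq_sym.
rewrite odd_permM signr_addb.
under [in RHS]eq_fun do rewrite permM.
by rewrite (ft (fun i => v (s i))) -!mulrA mulrCA signrMK.
Qed.

End Alternation.
Arguments tensor_pow {R E k} a j v.

(** * Wedge products as alternating sums *)

Section Wedge.
Variables (R : realType) (m : nat).

Lemma wedge_altsum k l (a : form R m k) (b : form R m l) v :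
  wedge a (altsum b) v = k`!%:R^-1 * altsum (tensor a b) v.
Proof.
rewrite /wedge natrM invfM -mulrA; congr (_ * _).
rewrite (altsum_tensor a b v) mulKf // pnatr_eq0 -lt0n; exact: fact_gt0.
Qed.

Lemma wedgeZr k l (a : form R m k) (b : form R m l) c v :
  wedge a (fun u => c * b u) v = c * wedge a b v.
Proof.
rewrite /wedge mulrCA; congr (_ * _); rewrite mulr_sumr.
by apply: eq_bigr => s _; rewrite mulrCA.
Qed.

(** The constants by which the normalized wedge powers differ from the plain
    alternating sums only matter through being nonzero. *)
Lemma wedge_powE k (a : form R m k) j :
  exists2 c : R, c != 0 &
    wedge_pow a j = fun v => c * altsum (tensor_pow a j) v.
Proof.
elim: j => [|j [c c0 IH]].
  by exists 1; rewrite ?oner_eq0 //; apply/funext => v; rewrite altsum0 mul1r.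
exists (c * k`!%:R^-1).
  by rewrite mulf_neq0 // invr_eq0 pnatr_eq0 -lt0n fact_gt0.
by apply/funext => v; rewrite /= IH wedgeZr wedge_altsum mulrA.
Qed.

End Wedge.

Section Contraction.
Variables (R : numFieldType) (E : Type).
Implicit Types (al : E -> R) (w : E -> E -> R).

Definition form1 al : ('I_1 -> E) -> R := fun v => al (v ord0).
Definition form2 w : ('I_2 -> E) -> R := fun v => w (v ord0) (v ord_max).

Lemma sgnsym_first_pair w l (f : ('I_l -> E) -> R) :
  (forall a b, w a b = - w b a) ->
  sgnsym (tensor (form2 w) f) (tperm (lshift l ord0) (lshift l ord_max)).
Proof.
move=> wN v; rewrite /tensor /form2 odd_tperm /= expr1 mulN1r tpermL tpermR.
rewrite wN mulNr.
by congr (- (_ * f _)); apply/funext => j; rewrite tpermD.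
Qed.

(** Exchanging two pairs is an even permutation, and products commute. *)
Lemma sgnsym_pair_swap w l (f : ('I_l -> E) -> R) :
  sgnsym (tensor (form2 w) (tensor (form2 w) f))
    (tperm (lshift (2 + l) ord0) (rshift 2 (lshift l ord0)) *
     tperm (lshift (2 + l) ord_max) (rshift 2 (lshift l ord_max)))%g.
Proof.
move=> v; rewrite odd_permM !odd_tperm /= expr0 mul1r /tensor /form2 !permM.
rewrite tpermL tpermR !(@tpermD _ (lshift (2 + l) ord0)) //.
rewrite tpermL tpermR !(@tpermD _ (lshift (2 + l) ord_max)) //.
rewrite mulrCA; congr (_ * (_ * f _)); apply/funext => j.
by rewrite permM !tpermD.
Qed.

(** The symmetries of [w v_0 v_1 * w v_2 v_3 * ...] act transitively on
    positions: exchange the first two pairs, move inside the tail, or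
    exchange the two arguments of the first [w]. *)
Lemma tensor_pow_transitive w k (j : 'I_(k.+1 * 2)) :
  (forall a b, w a b = - w b a) ->
  exists2 t : 'S_(k.+1 * 2), t (lshift (k * 2) (ord0 : 'I_2)) = j
    & sgnsym (tensor_pow (form2 w) k.+1) t.
Proof.
move=> wN; have first_pair l (i : 'I_2) (f : ('I_l -> E) -> R) :
    exists2 t : 'S_(2 + l), t (lshift l ord0) = lshift l i
      & sgnsym (tensor (form2 w) f) t.
  case: (ord2_cases i) => ->.
    exists 1%g; first by rewrite perm1.
    move=> v; rewrite odd_perm1 mul1r; congr tensor.
    by apply/funext => x; rewrite perm1.
  by eexists; last exact: sgnsym_first_pair; rewrite tpermL.
elim: k j => [|k IH] j; rewrite -(@splitK 2 _ j);
  case: (fintype.split _) => i //=.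
- exact: first_pair.
- by case: i.
- exact: first_pair.
have [t ti st] := IH i.
eexists; last first.
  by apply: sgnsymM; [exact: sgnsym_pair_swap | exact: sgnsym_shift_perm st].
rewrite !permM tpermL tpermD //.
exact (etrans (@shift_perm_rshift 2 (k.+1 * 2) t (lshift (k * 2) (ord0 : 'I_2)))
         (congr1 (@rshift 2 (k.+1 * 2)) ti)).
Qed.

(** The contraction formula iota_u (w ^ (k + 1)) = (k + 1) (iota_u w) wedge w
    ^ k for the first argument u, in the case where u pairs to zero with
    every argument but the second. By transitivity u may be kept in first
    position, and then its partner has to be the second argument. *)
Lemma altsum_contract w k (v : 'I_(k.+1 * 2) -> E) :
  (forall a b, w a b = - w b a) ->
  (forall j, w (v (lshift (k * 2) (ord0 : 'I_2))) (v (rshift 2 j)) = 0) ->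
  altsum (tensor_pow (form2 w) k.+1) v =
    (k.+1 * 2)%:R * (w (v (lshift (k * 2) (ord0 : 'I_2)))
       (v (lshift (k * 2) (ord_max : 'I_2))) *
     altsum (tensor_pow (form2 w) k) (fun j => v (rshift 2 j))).
Proof.
move=> wN w0.
rewrite (altsum_fix_point _ (fun j => tensor_pow_transitive j wN)).
congr (_ * _).
apply: (sum_tensor_fixing (a := form2 w)) => [s /forallP/(_ ord0)//|s s0].
rewrite negb_forall => /existsP[i si].
have {si} : s (lshift (k * 2) (ord_max : 'I_2)) !=
    lshift (k * 2) (ord_max : 'I_2).
  by apply: contraNneq si => s1; case: (ord2_cases i) => ->; rewrite ?s1.
rewrite /form2 (eqP s0); set p := s _; have : p != lshift (k * 2) ord0.
  by rewrite -(eqP s0) (inj_eq perm_inj).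
rewrite -(@splitK 2 (k * 2) p).
case: (fintype.split p) => i' /=; last by rewrite w0.
by case: (ord2_cases i') => ->; rewrite eqxx.
Qed.

End Contraction.

(** * Multilinear algebra on a vector space *)

Section Multilinear.
Variables (R : numFieldType) (U : lmodType R).

Definition update N (v : 'I_N -> U) i y : 'I_N -> U :=
  fun j => if j == i then y else v j.

Definition multilinear N (f : ('I_N -> U) -> R) := forall i v a y z,
  f (update v i (a *: y + z)) = a * f (update v i y) + f (update v i z).

Lemma multilinear_altsum N (f : ('I_N -> U) -> R) :
  multilinear f -> multilinear (altsum f).
Proof.
move=> lf i v a y z; rewrite /altsum mulr_sumr -big_split.
apply: eq_bigr => s _ /=.
have upds x : (fun j => update v i x (s j)) =
    update (fun j => v (s j)) (s^-1%g i) x.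
  by apply/funext => j; rewrite /update (canF_eq (permK s)).
by rewrite !upds lf mulrDr mulrCA.
Qed.

Lemma multilinear_tensor k l (a : ('I_k -> U) -> R) (b : ('I_l -> U) -> R) :
  multilinear a -> multilinear b -> multilinear (tensor a b).
Proof.
move=> la lb i v c y z; rewrite -(splitK i) /tensor.
case: (fintype.split i) => i' /=.
  have updl x : (fun j => update v (lshift l i') x (lshift l j)) =
      update (fun j => v (lshift l j)) i' x.
    by apply/funext => j; rewrite /update (inj_eq (@lshift_inj _ _)).
  have updr x : (fun j => update v (lshift l i') x (rshift k j)) =
      (fun j => v (rshift k j)).
    by apply/funext => j; rewrite /update eq_rlshift.
  by rewrite !updl !updr la mulrDl mulrA.
have updl x : (fun j => update v (rshift k i') x (lshift l j)) =
    (fun j => v (lshift l j)).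
  by apply/funext => j; rewrite /update eq_lrshift.
have updr x : (fun j => update v (rshift k i') x (rshift k j)) =
    update (fun j => v (rshift k j)) i' x.
  by apply/funext => j; rewrite /update (inj_eq (@rshift_inj _ _)).
by rewrite !updl !updr lb mulrDr mulrCA.
Qed.

Lemma multilinear_tensor_pow k (a : ('I_k -> U) -> R) j :
  multilinear a -> multilinear (tensor_pow a j).
Proof.
by move=> la; elim: j => [[]//|j IH]; exact: multilinear_tensor.
Qed.

Lemma multilinear_form1 (al : U -> R) :
  (forall a y z, al (a *: y + z) = a * al y + al z) -> multilinear (form1 al).
Proof.
by move=> al_lin i v a y z; rewrite (ord1 i) /form1 /update eqxx al_lin.
Qed.

Lemma multilinear_form2 (w : U -> U -> R) :
  (forall a y z b, w (a *: y + z) b = a * w y b + w z b) ->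
  (forall a b, w a b = - w b a) -> multilinear (form2 w).
Proof.
move=> wl wN i v a y z; rewrite /form2 /update !(eq_sym _ i).
case: (ord2_cases i) => ->; rewrite eqxx /= ?wl //.
by rewrite wN wl opprD -mulrN -!(wN (v ord0)).
Qed.

End Multilinear.

Section VectorSpace.
Variables (R : numFieldType) (U : vectType R).
Implicit Types (al : U -> R) (w : U -> U -> R).

(** The arguments are moved into the spanning family one at a time, by
    induction on the number [k] of arguments that are still arbitrary. *)
Lemma multilinear_eq0 N (f : ('I_N -> U) -> R) (X : seq U) :
  multilinear f -> <<X>>%VS = fullv ->
  (forall v, (forall i, v i \in X) -> f v = 0) -> forall v, f v = 0.
Proof.
move=> lf spanX f0 v.
suff H k : (k <= N)%N ->
    forall v, (forall i : 'I_N, (k <= i)%N -> v i \in X) -> f v = 0.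
  by apply: (H N) => // i; rewrite leqNgt ltn_ord.
elim: k => [_ u uX|k IH kN u uX]; first by apply: f0 => i; exact: uX.
pose i := Ordinal kN.
have f_upd y : y \in X -> f (update u i y) = 0.
  move=> yX; apply: IH => [|j]; first exact: ltnW.
  rewrite /update -val_eqE /= leq_eqVlt eq_sym.
  by case: eqP => //= _; exact: uX.
have fu0 : f (update u i 0) = 0.
  have := lf i u (-1) 0 0; rewrite scaler0 addr0 mulN1r => /eqP.
  by rewrite -subr_eq0 addNr subr0 => /eqP.
rewrite (_ : u = update u i (u i)); last first.
  by apply/funext => j; rewrite /update; case: eqP => [->|].
have : u i \in <<in_tuple X>>%VS by rewrite spanX memvf.
move/coord_span => ->.
apply: (big_rec (fun y => f (update u i y) = 0)) => // j y _ fy.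
by rewrite lf fy f_upd ?mulr0 ?addr0 // mem_nth.
Qed.


(** Given arguments [v] on which the power [k] is nonzero, the [k * 2] linear
    conditions [w u (v i) = 0] leave some nonzero [u] in [W], which pairs
    nontrivially with some [b] of [W]; by the contraction formula the power
    [k + 1] is nonzero on [u, b, v]. *)
Lemma altsum_tensor_pow_neq0 w (W : {vspace U}) k :
  (forall a y z b, w (a *: y + z) b = a * w y b + w z b) ->
  (forall a b, w a b = - w b a) ->
  (forall a, a \in W -> a != 0 -> exists2 b, b \in W & w a b != 0) ->
  (k * 2 <= \dim W)%N ->
  exists2 v, (forall i, v i \in W) & altsum (tensor_pow (form2 w) k) v != 0.
Proof.
move=> wl wN wnd; elim: k => [_|k IH dimW].
  by exists (fun=> 0) => [[]//|]; rewrite altsum0 /= oner_eq0.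
have [|v vW v0] := IH; first by apply: leq_trans dimW; rewrite leq_mul2r leqnSn.
pose phi a : 'rV[R]_(k * 2) := \row_i w a (v i).
have phi_lin : linear phi by move=> a y z; apply/rowP => i; rewrite !mxE wl.
pose phiM := GRing.isLinear.Build _ _ _ _ phi phi_lin.
pose phiL : {linear U -> 'rV[R]_(k * 2)} := HB.pack phi phiM.
have : (W :&: lker (linfun phiL))%VS != 0%VS.
  rewrite -dimv_eq0; apply/negP => /eqP d0.
  have := limg_ker_dim (linfun phiL) W.
  rewrite d0 add0n => dE; have := dimvS (subvf (linfun phiL @: W)%VS).
  by rewrite dE dimvf /dim /= mul1n leqNgt (leq_trans _ dimW) // leqnSn.
rewrite -vpick0; set u := vpick _ => u0.
have := memv_pick (W :&: lker (linfun phiL))%VS.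
rewrite -/u memv_cap memv_ker lfunE.
case/andP=> uW /eqP/rowP phiu.
have wu i : w u (v i) = 0 by have := phiu i; rewrite !mxE.
have [b bW wub] := wnd u uW u0.
pose v' (i : 'I_(2 + k * 2)) := match fintype.split i with
  | inl i => if i == ord0 then u else b | inr j => v j end.
have v'l i : v' (lshift _ i) = if i == ord0 then u else b.
  by rewrite /v' (unsplitK (inl i)).
have v'r j : v' (rshift 2 j) = v j by rewrite /v' (unsplitK (inr j)).
exists v'.
  by move=> i; rewrite /v'; case: (fintype.split i) => // j; case: eqP.
rewrite altsum_contract // => [|j]; last by rewrite v'l v'r.
rewrite !v'l /= !mulf_neq0 // ?pnatr_eq0 //.
by rewrite (_ : (fun j => _) = v) //; apply/funext => j; rewrite v'r.
Qed.

Lemma tensor_pow_eq0 w k (v : 'I_(k * 2) -> U) j :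
  (forall a b, w a b = - w b a) ->
  (forall i, w (v j) (v i) = 0) -> tensor_pow (form2 w) k v = 0.
Proof.
move=> wN; elim: k v j => [|k IH] v; first by case.
move=> j; rewrite -(@splitK 2 _ j) /= /tensor.
case: (fintype.split j) => i /= w0; last first.
  by rewrite [X in _ * X](IH _ i) ?mulr0 // => i'; exact: w0.
rewrite /form2 [X in X * _](_ : _ = 0) ?mul0r //.
case: (ord2_cases i) w0 => -> w0; first exact: w0.
by apply/eqP; rewrite wN oppr_eq0; apply/eqP; exact: w0.
Qed.

(** Extend [u] to a basis of the kernel of [al] and add [r] with [al r <> 0].
    By multilinearity it is enough to take the arguments from this basis.
    A repetition gives zero by alternation, and otherwise [u] occurs: in a
    nonzero term [al] would have to take [r], but then some factor [w]
    pairs [u] with an element of the kernel. *)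
Lemma altsum_degenerate al w n (u : U) :
  (forall a y z, al (a *: y + z) = a * al y + al z) ->
  (forall a y z b, w (a *: y + z) b = a * w y b + w z b) ->
  (forall a b, w a b = - w b a) ->
  (\dim {: U} <= 1 + n * 2)%N ->
  u != 0 -> al u = 0 -> (forall b, al b = 0 -> w u b = 0) ->
  forall v, altsum (tensor (form1 al) (tensor_pow (form2 w) n)) v = 0.
Proof.
move=> al_lin wl wN dimU u0 alu wu v.
pose alM := GRing.isLinear.Build _ _ _ _ (al : U -> R^o) al_lin.
pose alL : {linear U -> R^o} := HB.pack (al : U -> R^o) alM.
pose K := lker (linfun alL).
have memK y : (y \in K) = (al y == 0) by rewrite memv_ker lfunE.
have [al0|] := pselect (forall y, al y = 0).
  rewrite /altsum big1 // => s _; by rewrite /tensor /form1 al0 mul0r mulr0.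
move/existsNP => [r /eqP r0].
pose X := [:: r, u & vbasis (K :\: <[u]>)].
have spanX : <<X>>%VS = fullv.
  rewrite !span_cons (span_basis (vbasisP _)).
  have uK : (<[u]> <= K)%VS by rewrite -memvE memK alu.
  have -> : (<[u]> + (K :\: <[u]>))%VS = K.
    by rewrite addvC -[X in (_ + X)%VS](capv_idPr uK) addv_diff_cap.
  apply/eqP; rewrite eqEsubv subvf; apply/subvP => y _.
  rewrite -(subrK ((al y / al r) *: r) y) addrC memv_add ?memvZ ?memv_line //.
  rewrite memK -[y]scale1r addrC -scaleNr al_lin.
  have -> : al (1 *: y) = al y by rewrite scale1r.
  by rewrite mulNr divfK // addNr.
(* K has codimension at least 1, so that X has at most dim U elements *)
have sizeX : (size X <= 1 + n * 2)%N.
  rewrite /= size_tuple; apply: leq_trans dimU.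
  have := dimv_cap_compl K <[u]>; have := limg_ker_dim (linfun alL) fullv.
  have uK : (<[u]> <= K)%VS by rewrite -memvE memK alu.
  rewrite capfv (capv_idPr uK) dim_vline u0 -/K => <- <-.
  rewrite [X in (_ <= X + _)%N]add1n.
  have : (0 < \dim (linfun alL @: fullv))%N.
    rewrite lt0n dimv_eq0; apply: contraNneq r0 => im0.
    by have := memv_img (linfun alL) (memvf r); rewrite im0 memv0 lfunE.
  by move=> im_gt0; rewrite addSn ltnS -addn1 leq_add2l.
apply: (multilinear_eq0 (X := X)) => //.
  apply/multilinear_altsum/multilinear_tensor; first exact: multilinear_form1.
  exact/multilinear_tensor_pow/multilinear_form2.
move=> {}v vX; have [v_inj|] := pselect (injective v); last first.
  move=> /existsNP[i /existsNP[j /not_implyP[vij /eqP ij]]].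
  exact: altsum_eq0 ij vij.
(* an injective family of 1 + 2n elements of X exhausts X *)
have uX : exists p, v p = u.
  have [|||_ XE] := @uniq_min_size _ (codom v) X;
    [|by move=> y /codomP[i ->]| |].
  - by rewrite map_inj_uniq // enum_uniq.
  - by rewrite size_codom card_ord.
  have : u \in codom v by rewrite XE !inE eqxx orbT.
  by case/codomP => p ->; exists p.
have [p vp] := uX; rewrite /altsum big1 // => s _; apply/eqP.
rewrite mulf_eq0 signr_eq0 /= /tensor mulf_eq0 /form1; set s0 := s _.
have [//|als0] := eqVneq (al (v s0)) 0.
have vE i : i != s0 -> al (v i) = 0.
  have inX j : (v j == r) || (al (v j) == 0).
    have := vX j; rewrite !inE; case: eqP => //= _ /orP[/eqP ->|/vbasis_mem].
      by rewrite alu.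
    by move/(subvP (diffvSl _ _)); rewrite memK.
  have := inX s0; rewrite (negPf als0) orbF => /eqP vs0.
  have := inX i; rewrite -vs0 => /orP[/eqP /v_inj -> |/eqP //]; by rewrite eqxx.
have ps0 : p != s0 by apply: contraNneq als0 => <-; rewrite vp alu.
apply/eqP; have : s^-1%g p != lshift (n * 2) ord0.
  by rewrite (canF_eq (permKV s)).
case E: (fintype.split (s^-1%g p : 'I_(1 + n * 2))) => [i|j].
  have := splitK (s^-1%g p : 'I_(1 + n * 2)); rewrite E /= (ord1 i) => <-.
  by rewrite eqxx.
move=> _; apply: (@tensor_pow_eq0 _ _ _ j) => // i.
have -> : v (s (rshift 1 j)) = u.
  have := splitK (s^-1%g p : 'I_(1 + n * 2)); rewrite E /= => ->.
  by rewrite permKV.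
by apply: wu; apply: vE; rewrite (inj_eq perm_inj) eq_rlshift.
Qed.

(** The kernel of [al] has dimension at least [n * 2], which leaves room for
    arguments [v] in it on which the power of [w] is nonzero. Put a vector
    [r] with [al r <> 0] in front of them: as [al] kills [v], only the
    permutations that keep [r] in front contribute. *)
Lemma altsum_neq0_iff_nondegenerate al w n :
  (forall a y z, al (a *: y + z) = a * al y + al z) ->
  (forall a y z b, w (a *: y + z) b = a * w y b + w z b) ->
  (forall a b, w a b = - w b a) ->
  \dim {: U} = (1 + n * 2)%N -> (exists r, al r != 0) ->
  (exists v, altsum (tensor (form1 al) (tensor_pow (form2 w) n)) v != 0) <->
  (forall a, al a = 0 -> (forall b, al b = 0 -> w a b = 0) -> a = 0).
Proof.
move=> al_lin wl wN dimU [r r0]; split=> [[v v0] a ala wa|nd].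
  apply/eqP; apply: contraNT v0 => a0.
  by rewrite (altsum_degenerate al_lin wl wN _ a0 ala wa) ?dimU.
pose alM := GRing.isLinear.Build _ _ _ _ (al : U -> R^o) al_lin.
pose alL : {linear U -> R^o} := HB.pack (al : U -> R^o) alM.
pose K := lker (linfun alL).
have memK y : (y \in K) = (al y == 0) by rewrite memv_ker lfunE.
have dimK : (n * 2 <= \dim K)%N.
  have := limg_ker_dim (linfun alL) fullv; rewrite capfv dimU -/K => dE.
  have := dimvS (subvf (linfun alL @: fullv)%VS); rewrite dimvf /dim /= => im1.
  by rewrite -(leq_add2l 1) -dE addnC leq_add2r.
have [a|v vK v0] := @altsum_tensor_pow_neq0 w K n wl wN _ dimK.
  rewrite memK => /eqP ala a0; apply/not_exists2P => h; move/eqP: a0; apply.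
  apply: nd => // b alb; apply/eqP; have := h b; rewrite memK alb eqxx.
  by case=> // /negP; rewrite negbK.
pose v' (i : 'I_(1 + n * 2)) := if fintype.split i is inr j then v j else r.
have v'l i : v' (lshift _ i) = r by rewrite /v' (unsplitK (inl i)).
have v'r j : v' (rshift 1 j) = v j by rewrite /v' (unsplitK (inr j)).
exists v'.
rewrite /altsum (@sum_tensor_fixing _ _ _ _ _ _ _ xpredT) // => [|s _].
  rewrite /form1 v'l mulf_neq0 // (_ : (fun j => _) = v) //.
  by apply/funext => j; rewrite v'r.
rewrite negb_forall => /existsP[i]; rewrite (ord1 i) /form1.
rewrite -(splitK (s _)); case: (fintype.split _) => i' /=.
  by rewrite (ord1 i') eqxx.
by move=> _; rewrite v'r; apply/eqP; rewrite -memK.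
Qed.

End VectorSpace.

(** * Calculus on the sphere *)

Section Dot.
Variables (R : realType) (m : nat).
Implicit Types (u v w : 'rV[R]_m) (a : R).

Lemma dotC u v : dot u v = dot v u.
Proof. by apply: eq_bigr => i _; rewrite mulrC. Qed.

Lemma dot_linear u a v w : dot u (a *: v + w) = a * dot u v + dot u w.
Proof.
rewrite /dot mulr_sumr -big_split; apply: eq_bigr => i _ /=.
by rewrite !mxE mulrDr mulrCA.
Qed.

Lemma dotDr u v w : dot u (v + w) = dot u v + dot u w.
Proof. by rewrite -[v]scale1r dot_linear mul1r scale1r. Qed.

Lemma dotr0 u : dot u 0 = 0.
Proof. by apply: big1 => i _; rewrite mxE mulr0. Qed.

Lemma dotZr u a v : dot u (a *: v) = a * dot u v.
Proof. by rewrite -[_ *: v]addr0 dot_linear dotr0 addr0. Qed.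

Lemma dotBr u v w : dot u (v - w) = dot u v - dot u w.
Proof. by rewrite dotDr -scaleN1r dotZr mulN1r. Qed.

Lemma dotDl u v w : dot (u + v) w = dot u w + dot v w.
Proof. by rewrite !(dotC _ w) dotDr. Qed.

Lemma dotZl a u v : dot (a *: u) v = a * dot u v.
Proof. by rewrite !(dotC _ v) dotZr. Qed.

Lemma dotBl u v w : dot (u - v) w = dot u w - dot v w.
Proof. by rewrite !(dotC _ w) dotBr. Qed.

Lemma dot_ge0 u : 0 <= dot u u.
Proof. by apply: sumr_ge0 => i _; rewrite -expr2 sqr_ge0. Qed.

Lemma dot_eq0 u : (dot u u == 0) = (u == 0).
Proof.
apply/eqP/eqP => [/eqP|->]; last by rewrite dotr0.
rewrite psumr_eq0 => [/allP u0|i _]; last by rewrite -expr2 sqr_ge0.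
apply/rowP => i; rewrite mxE; apply/eqP; rewrite -sqrf_eq0 expr2.
exact: (u0 i (mem_index_enum i)).
Qed.

(** [dot u] as a map into the regular module, the codomain that the linear and
    differential structures expect. *)
Definition dotl u : 'rV[R]_m -> R^o := dot u.

Lemma dotl_linear u : linear (dotl u).
Proof. by move=> a v w; rewrite /dotl dot_linear. Qed.

HB.instance Definition _ u :=
  GRing.isLinear.Build R 'rV[R]_m R^o *:%R (dotl u) (dotl_linear u).

Lemma mem_orthov u v : (v \in orthov u) = (dot u v == 0).
Proof. by rewrite memv_ker (lfunE (dotl u)). Qed.

Lemma mem_perp (V : 'rV[R]_m -> 'rV[R]_m) x v :
  (v \in perp V x) = (v \in tangent x) && (dot (V x) v == 0).
Proof. by rewrite memv_cap [v \in orthov (V x)]mem_orthov. Qed.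

End Dot.


Section Smooth.
Variables (R : realType) (m : nat).
Local Notation E := 'rV[R]_m.

Lemma continuous_dotl (u : E) : continuous (dotl u).
Proof.
move=> z; apply: (@differentiable_continuous _ _ _ z (dotl u)).
rewrite (_ : dotl u =
    \sum_(i < m) (fun y : E => u 0 i *: (y 0 i : R^o))); last first.
  by apply/funext => y; rewrite fct_sumE.
apply: differentiable_sum => i.
apply: (@differentiableZ _ _ _ (fun y : E => y 0 i : R^o)).
exact: differentiable_coord.
Qed.

Lemma differentiable_dotl (u y : E) : differentiable (dotl u) y.
Proof. by apply: linear_differentiable; exact: continuous_dotl. Qed.

Lemma derive_dotl (u v y : E) : 'D_v (dotl u) y = dot u v.
Proof.
rewrite deriveE; last exact: differentiable_dotl.
by rewrite diff_lin //; exact: continuous_dotl.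
Qed.

(** It reduces calculus for vector-valued maps to scalar functions times
    constant vectors. *)
Lemma row_as_sum (F : E -> E) :
  F = \sum_(i < m) (fun y => F y 0 i *: delta_mx 0 i).
Proof.
by apply/funext => y; rewrite {1}[F y]row_sum_delta fct_sumE.
Qed.

Lemma differentiable_row (F : E -> E) (y : E) :
  (forall i, differentiable (fun z => F z 0 i : R^o) y) -> differentiable F y.
Proof.
move=> dF; rewrite (row_as_sum F); apply: differentiable_sum => i.
exact: differentiableZl (dF i).
Qed.

Lemma Ck_cst (F : normedModType R) (c : F) k : Ck k setT (cst c : E -> F).
Proof.
elim: k c => [|k IH] c /=; first by move=> x _; exact: cst_continuous.
split=> [x _|v]; first exact: differentiable_cst.
by rewrite (_ : (fun x => _) = cst 0) //; apply/funext => x; rewrite derive_cst.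
Qed.

Lemma CkS (F : normedModType R) (f : E -> F) k :
  Ck k.+1 setT f -> Ck k setT f.
Proof.
elim: k f => [|k IH] f [df Df].
  by move=> x _; apply: differentiable_continuous; exact: df.
by split=> // v; apply: IH; exact: Df.
Qed.

Lemma Ck_add (F : normedModType R) (f g : E -> F) k :
  Ck k setT f -> Ck k setT g -> Ck k setT (f + g).
Proof.
elim: k f g => [|k IH] f g.
  by move=> cf cg x _; apply: continuousD; [exact: (cf x I)|exact: (cg x I)].
move=> [df Df] [dg Dg]; split=> [x _|v].
  by apply: differentiableD; [exact: df|exact: dg].
rewrite (_ : (fun x => _) = (fun x => 'D_v f x) + (fun x => 'D_v g x)).
  by apply: IH; [exact: Df|exact: Dg].
by apply/funext => x; rewrite deriveD//; apply: diff_derivable;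
  [exact: df|exact: dg].
Qed.

Lemma Ck_mul (f g : E -> R^o) k :
  Ck k setT f -> Ck k setT g -> Ck k setT (f * g).
Proof.
elim: k f g => [|k IH] f g.
  by move=> cf cg x _; apply: continuousM; [exact: (cf x I)|exact: (cg x I)].
move=> cf cg; case: (cf) (cg) => [df Df] [dg Dg]; split=> [x _|v].
  by apply: differentiableM; [exact: df|exact: dg].
rewrite (_ : (fun x => _) = f * (fun x => 'D_v g x) + g * (fun x => 'D_v f x)).
  by apply: Ck_add; apply: IH; do ?[exact: CkS]; [exact: Dg|exact: Df].
by apply/funext => x; rewrite deriveM//; apply: diff_derivable;
  [exact: df|exact: dg].
Qed.

Lemma Ck_scalel (F : normedModType R) (c : F) (f : E -> R^o) k :
  Ck k setT f -> Ck k setT (fun y => f y *: c).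
Proof.
elim: k f => [|k IH] f.
  by move=> cf x _; apply: (@continuousZr_tmp _ F E f); exact: (cf x I).
move=> [df Df]; split=> [x _|v]; first exact: differentiableZl (df _ _).
rewrite (_ : (fun x => _) = (fun x => 'D_v f x *: c)).
   by apply: IH; exact: Df.
apply/funext => x; rewrite deriveE; last exact: differentiableZl (df _ _).
by rewrite diffZl ?deriveE //; exact: df.
Qed.

Lemma Ck_sum (F : normedModType R) (I : Type) (r : seq I) (f : I -> E -> F) k :
  (forall i, Ck k setT (f i)) -> Ck k setT (\sum_(i <- r) f i).
Proof.
by move=> cf; apply: big_ind => [|g h|i _] //; [exact: Ck_cst|exact: Ck_add].
Qed.

Lemma Ck_dotl (u : E) k : Ck k setT (dotl u).
Proof.
case: k => [|k]; first by move=> x _; exact: continuous_dotl.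
split=> [x _|v]; first exact: differentiable_dotl.
rewrite (_ : (fun x => _) = cst (dot u v)); first exact: Ck_cst.
by apply/funext => x; rewrite derive_dotl.
Qed.

Lemma dotl_delta (i : 'I_m) (y : E) : dotl (delta_mx 0 i) y = y 0 i.
Proof.
rewrite /dotl /dot (bigD1 i) //= mxE !eqxx mul1r big1 ?addr0 // => j ji.
by rewrite mxE (negPf ji) andbF mul0r.
Qed.

(** The tangential part of the constant field [C]: a smooth field on the
    sphere with an arbitrary prescribed tangent value at a given point. *)
Definition tangent_field (C y : E) : E := C - dot C y *: y.

Lemma Ck_tangent_field (C : E) k : Ck k setT (tangent_field C).
Proof.
rewrite (row_as_sum (tangent_field C)); apply: Ck_sum => i; apply: Ck_scalel.
rewrite (_ : (fun y => _) = cst (C 0 i) + dotl (- C) * dotl (delta_mx 0 i)).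
  by apply: Ck_add; [exact: Ck_cst | apply: Ck_mul; exact: Ck_dotl].
apply/funext => y; rewrite /tangent_field !mxE /= /cst !fctE dotl_delta /dotl.
by rewrite -[- C]scaleN1r dotZl mulN1r mulNr.
Qed.

Lemma vector_field_tangent_field (C : E) : vector_field (tangent_field C).
Proof.
split=> [x _|x xS].
  exists setT, (tangent_field C); split => //;
    [exact: openT | move=> k; exact: Ck_tangent_field].
by rewrite mem_orthov dotBr dotZr xS mulr1 dotC subrr.
Qed.

Lemma sphere_neq0 (x : E) : sphere R m x -> x != 0.
Proof.
move=> xS; rewrite -dot_eq0; move: xS; rewrite /sphere /= => ->.
exact: oner_neq0.
Qed.

Lemma normalize_sphere (x : E) : x != 0 -> sphere R m (normalize x).
Proof.
move=> x0; rewrite /sphere /= /normalize dotZl dotZr mulrA -invfM -expr2.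
by rewrite sqr_sqrtr ?dot_ge0 // mulVf // dot_eq0.
Qed.

Lemma normalize_id (x : E) : sphere R m x -> normalize x = x.
Proof.
by rewrite /sphere /normalize /= => ->; rewrite sqrtr1 invr1 scale1r.
Qed.

Lemma near_neq0 (x : E) : x != 0 -> \forall y \near x, y != 0.
Proof.
move=> x0; apply: (@open_nbhs_nbhs _ _ [set y : E | y != 0]); split => //.
have c0 : closed [set (0 : E)].
  apply: accessible_closed_set1; apply: hausdorff_accessible.
  exact: norm_hausdorff.
rewrite (_ : [set y | _] = ~` [set 0]); first exact: closed_openC.
by apply/seteqP; split => y /=; move/eqP.
Qed.

Lemma differentiable_normalize (x : E) :
  x != 0 -> differentiable (@normalize R m) x.
Proof.
move=> x0; apply: differentiable_row => i.
rewrite (_ : (fun z => _) =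
    (fun z => (Num.sqrt (dot z z))^-1) * dotl (delta_mx 0 i)); last first.
  by apply/funext => z; rewrite fctE dotl_delta mxE.
apply: differentiableM; last exact: differentiable_dotl.
have dgt0 : 0 < dot x x by rewrite lt_def dot_eq0 x0 dot_ge0.
apply: differentiableV; last by rewrite gt_eqF // sqrtr_gt0.
apply: (@differentiable_comp _ _ _ _ (fun z : E => dot z z) Num.sqrt).
  rewrite (_ : (fun z => _) =
      \sum_(j < m) (dotl (delta_mx 0 j) * dotl (delta_mx 0 j))).
    apply: differentiable_sum => j.
    by apply: differentiableM; exact: differentiable_dotl.
  apply/funext => z; rewrite fct_sumE; apply: eq_bigr => j _.
  by rewrite fctE dotl_delta.
apply/derivable1_diffP.
exact: (@ex_derive _ _ _ _ _ _ _ (is_derive1_sqrt dgt0)).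
Qed.

Lemma dot_derive (w : E) (F : E -> E) (x v : E) : differentiable F x ->
  'D_v (dotl w \o F) x = dot w ('D_v F x) :> R^o.
Proof.
move=> dF; rewrite deriveE; last first.
  by apply: differentiable_comp => //; exact: differentiable_dotl.
rewrite deriveE // diff_comp //; last exact: differentiable_dotl.
by rewrite /= diff_lin //; exact: continuous_dotl.
Qed.

(** Only the component of the derivative along [x] survives when [C] is
    tangent at [x], because the coefficient [dot C] vanishes there; hence
    the bracket of two such fields is normal to the sphere at [x]. *)
Lemma dot_sderive_tangent_field (w C x B : E) : sphere R m x ->
  dot w x = 0 -> dot C x = 0 -> dot w (sderive (tangent_field C) x B) = 0.
Proof.
move=> xS wx Cx; have x0 := sphere_neq0 xS.
have dN := differentiable_normalize x0.
have dotN u : differentiable (dotl u \o @normalize R m) x.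
  by apply: differentiable_comp => //; exact: differentiable_dotl.
rewrite /sderive -dot_derive; last first.
  apply: differentiable_comp => //.
  by have [dC _] := @Ck_tangent_field C 1; exact: dC.
rewrite (_ : dotl w \o _ = cst (dot w C) -
    (dotl C \o @normalize R m) * (dotl w \o @normalize R m)).
  rewrite deriveB //; last by apply: diff_derivable; exact: differentiableM.
  rewrite derive_cst deriveM //; try exact: diff_derivable.
  by rewrite /= normalize_id // /dotl wx Cx !scale0r addr0 subr0.
by apply/funext => y; rewrite !fctE /= /dotl /tangent_field dotBr dotZr.
Qed.

End Smooth.

(** * The Levi-Civita connection and the adjoint *)

Section Connection.
Variables (R : realType) (m : nat).
Local Notation E := 'rV[R]_m.
Variable nabla : (E -> E) -> E -> E -> E.
Hypothesis lc : levi_civita nabla.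

Lemma tangent_field_id (x C : E) : C \in tangent x -> tangent_field C x = C.
Proof.
by rewrite mem_orthov dotC /tangent_field => /eqP ->; rewrite scale0r subr0.
Qed.

(** The usual formula for d alpha through a torsion-free metric connection.
    Both vectors are extended by their tangential fields, for which the
    derivatives of alpha are those of the constant vectors, as [V] is
    tangent. Metric compatibility leaves the terms of the connection
    applied to the extensions; by torsion-freeness they combine into alpha
    of a bracket that is normal to the sphere. *)
Lemma dform1_alphaE (V : E -> E) (x B C : E) :
  vector_field V -> sphere R m x -> B \in tangent x -> C \in tangent x ->
  dform1 (alpha V) x B C = dot (nabla V x B) C - dot (nabla V x C) B.
Proof.
move=> vV xS Bx Cx; have Vx := vV.2 x xS.
have metric D B' : D \in tangent x -> B' \in tangent x ->
    sderive (fun y => alpha V y D : R^o) x B' =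
    dot (nabla V x B') D + dot (V x) (nabla (tangent_field D) x B').
  move=> Dx B'x; have := lc_metric lc vV (vector_field_tangent_field D) xS B'x.
  rewrite tangent_field_id // => <-; rewrite /sderive; congr ('D__ _ _).
  apply/funext => z /=; rewrite /alpha /tangent_field dotBr dotZr.
  (* the origin is normalized to 0, where the correction term also vanishes *)
  have [->|z0] := eqVneq z 0.
    by rewrite /normalize scaler0 !dotr0 mul0r subr0.
  have nzS := normalize_sphere z0; have := vV.2 _ nzS.
  by rewrite mem_orthov dotC => /eqP ->; rewrite mulr0 subr0.
rewrite /dform1 !metric //.
have := lc_torsion_free lc (vector_field_tangent_field B)
  (vector_field_tangent_field C) xS.
rewrite !tangent_field_id // /lie_bracket !tangent_field_id //.
move=> /(congr1 (dot (V x))).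
have /eqP Vx0 : dot (V x) x == 0 by rewrite dotC -mem_orthov.
rewrite !dotBr !dot_sderive_tangent_field //; last 2 first.
- by rewrite dotC; apply/eqP; rewrite -mem_orthov.
- by rewrite dotC; apply/eqP; rewrite -mem_orthov.
rewrite subrr => /eqP; rewrite subr_eq0 => /eqP ->.
by rewrite opprD addrACA subrr addr0.
Qed.

(** Orthogonality to [V x] comes from differentiating the constant <V, V>;
    tangency is part of the smoothness axiom, applied along a field
    through [B]. *)
Lemma nabla_perp (V : E -> E) (x B : E) :
  vector_field V -> (forall y, sphere R m y -> dot (V y) (V y) = 1) ->
  sphere R m x -> B \in tangent x -> nabla V x B \in perp V x.
Proof.
move=> vV uV xS Bx; rewrite memv_cap; apply/andP; split.
  have := (lc_smooth lc (vector_field_tangent_field B) vV).2 x xS.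
  by rewrite tangent_field_id.
have := lc_metric lc vV vV xS Bx.
rewrite /sderive (@near_eq_derive _ _ _ _ (cst (1 : R^o))); last first.
  have := near_neq0 (sphere_neq0 xS); apply: filterS => y y0.
  by rewrite /= uV //; exact: normalize_sphere.
rewrite derive_cst [dot (nabla _ _ _) _]dotC -mulr2n => /esym/eqP.
by rewrite mulrn_eq0 /= mem_orthov.
Qed.

End Connection.

Section Adjoint.
Variables (R : realType) (m : nat) (W : {vspace 'rV[R]_m}).
Implicit Types (T : 'End(subvs_of W)) (a b c : subvs_of W).

Local Notation "<| a , b |>" := (dot (vsval a) (vsval b)).

Lemma subdot_eq0 a : (forall b, <|a, b|> = 0) -> a = 0.
Proof.
move=> h; apply: subvs_inj; rewrite linear0.
by apply/eqP; rewrite -dot_eq0 h.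
Qed.

Let d := \dim (fullv : {vspace subvs_of W}).
Let e : d.-tuple (subvs_of W) := vbasis fullv.

(** The Riesz map in the basis [e]. It is injective since the form is
    definite, hence invertible, which yields adjoints. *)
Definition gram_fun a : 'rV[R]_d := \row_i <|a, e`_i|>.

Lemma gram_linear : linear gram_fun.
Proof. by move=> k a b; apply/rowP => i; rewrite !mxE linearP dotDl dotZl. Qed.

HB.instance Definition _ :=
  GRing.isLinear.Build R _ _ *:%R gram_fun gram_linear.

Lemma adjoint_exists T : exists T' : 'End(subvs_of W),
  forall b c, <|T b, c|> = <|b, T' c|>.
Proof.
pose psi c : 'rV[R]_d := \row_i <|T e`_i, c|>.
have psi_lin : linear psi.
  by move=> k a b; apply/rowP => i; rewrite !mxE linearP dot_linear.
pose psiM := GRing.isLinear.Build _ _ _ _ psi psi_lin.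
pose psiL : {linear subvs_of W -> 'rV[R]_d} := HB.pack psi psiM.
pose G := linfun gram_fun.
have dot_basis a b : <|a, b|> = \sum_i coord e i a * <|e`_i, b|>.
  rewrite {1}(coord_vbasis (memvf a)) linear_sum dotC.
  rewrite -[dot _ _]/(dotl (vsval b) _) linear_sum; apply: eq_bigr => i _.
  by rewrite !linearZ /= [RHS]/GRing.mul /= dotC.
have kerG : lker G == 0%VS.
  apply/lker0P => a b; rewrite !lfunE /= => Gab; apply/eqP; rewrite -subr_eq0.
  apply/eqP/subdot_eq0 => c; rewrite dotC dot_basis big1 // => i _.
  have /rowP/(_ i) := Gab; rewrite !mxE => Gabi.
  rewrite linearB /= dotBr (dotC _ (vsval a)) (dotC _ (vsval b)).
  by rewrite Gabi subrr mulr0.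
have limgG : limg G = fullv.
  apply/eqP; rewrite eqEdim subvf /= limg_dim_eq; last first.
    by rewrite (eqP kerG) capv0.
  by rewrite dimvf /dim /= mul1n.
exists (G^-1 \o linfun psiL)%VF => b c; rewrite comp_lfunE (lfunE psiL).
have GG : G ((G^-1)%VF (psi c)) = psi c.
  by apply: limg_lfunVK; rewrite limgG memvf.
rewrite [LHS](_ : _ = \sum_i coord e i b * <|T e`_i, c|>); last first.
  rewrite {1}(coord_vbasis (memvf b)) !linear_sum dotC.
  rewrite -[dot _ _]/(dotl (vsval c) _) linear_sum; apply: eq_bigr => i _.
  by rewrite !linearZ /= dotC.
rewrite dot_basis; apply: eq_bigr => i _; congr (_ * _).
have /rowP/(_ i) := GG; rewrite !lfunE /= !mxE => <-.
by rewrite dotC.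
Qed.

Lemma transposeE T b c : <|T b, c|> = <|b, transpose T c|>.
Proof.
rewrite /transpose; case: xgetP => [T' _ |/= none]; first exact.
by have [T' hT'] := adjoint_exists T; case: (none T').
Qed.

Lemma lker_skew_eq0 T :
  (lker (T - transpose T) == 0%VS) <->
  (forall a, (forall b, <|T a, b|> - <|T b, a|> = 0) -> a = 0).
Proof.
have skewE a b : <|T a, b|> - <|T b, a|> = <|(T - transpose T) a, b|>.
  rewrite add_lfunE opp_lfunE linearB /= dotBl.
  by rewrite (transposeE T b) (dotC (vsval b)).
split=> [/lker0P inj a ha|h].
  by apply: inj; rewrite linear0; apply: subdot_eq0 => b; rewrite -skewE.
rewrite -subv0; apply/subvP => a; rewrite memv_ker memv0 => /eqP a0.
by apply/eqP/h => b; rewrite skewE a0 linear0 dotC dotr0.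
Qed.

End Adjoint.

(** * Nondegeneracy at a point *)

Lemma tensor_pow_comp (R : numFieldType) (E F : Type) (h : F -> E) k
    (a : ('I_k -> E) -> R) j v :
  tensor_pow a j (fun i => h (v i)) =
    tensor_pow (fun u => a (fun i => h (u i))) j v.
Proof. by elim: j v => //= j IH v; rewrite /tensor IH. Qed.

Section Pointwise.
Variables (R : realType) (n : nat).
Local Notation m := (2 * n).+2.
Local Notation E := 'rV[R]_m.
Variables (V : E -> E) (nabla : (E -> E) -> E -> E -> E).
Hypothesis vV : vector_field V.
Hypothesis uV : forall x, sphere R m x -> dot (V x) (V x) = 1.
Hypothesis lc : levi_civita nabla.
Variable x : E.
Hypothesis xS : sphere R m x.

Lemma dim_tangent : \dim (tangent x) = (1 + n * 2)%N.
Proof.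
have := limg_ker_dim (linfun (dotl x)) fullv; rewrite capfv -/(tangent x).
rewrite [X in _ = X]dimvf /dim /= mul1n => dE.
have := dimvS (subvf (linfun (dotl x) @: fullv)%VS).
rewrite dimvf /dim /= => im1.
have im0 : (0 < \dim (linfun (dotl x) @: fullv))%N.
  rewrite lt0n dimv_eq0; apply/eqP => im0.
  have := memv_img (linfun (dotl x)) (memvf x).
  by rewrite im0 memv0 lfunE /= /dotl xS oner_eq0.
have im : \dim (linfun (dotl x) @: fullv) = 1%N.
  by apply/eqP; rewrite eqn_leq im1.
by move: dE; rewrite im addn1 => -[->]; rewrite mulnC.
Qed.

(** The exterior derivative of alpha at [x], through the connection, which
    makes it visibly bilinear on tangent vectors. *)
Definition dalpha (b c : E) : R := dot (nabla V x b) c - dot (nabla V x c) b.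

Lemma dalpha_linear a b c d : b \in tangent x -> c \in tangent x ->
  dalpha (a *: b + c) d = a * dalpha b d + dalpha c d.
Proof.
move=> bT cT; rewrite /dalpha (lc_linear lc) // dotDl dotZl dot_linear.
by rewrite opprD addrACA mulrBr.
Qed.

Lemma dalphaN b c : dalpha b c = - dalpha c b.
Proof. by rewrite /dalpha opprB. Qed.

Lemma contact_at_nondegenerate :
  (exists v : 'I_(1 + n * 2) -> E,
     (forall i, v i \in tangent x) /\ alpha_dalpha n V x v != 0) <->
  (forall b, b \in perp V x ->
     (forall c, c \in perp V x -> dalpha b c = 0) -> b = 0).
Proof.
pose U := subvs_of (tangent x).
pose al (b : U) := dot (V x) (vsval b).
pose w (b c : U) := dalpha (vsval b) (vsval c).
have al_lin a b c : al (a *: b + c) = a * al b + al c.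
  by rewrite /al linearP dot_linear.
have wl a b c d : w (a *: b + c) d = a * w b d + w c d.
  by rewrite /w linearP dalpha_linear ?subvsP.
have wN b c : w b c = - w c b by exact: dalphaN.
have dimU : \dim {: U} = (1 + n * 2)%N by rewrite dimvf -dim_tangent.
have [r r0] : exists r, al r != 0.
  exists (vsproj (tangent x) (V x)).
  by rewrite /al vsprojK ?vV.2 // uV // oner_eq0.
have [c c0 powE] := wedge_powE (form2 (dform1 (alpha V) x)) n.
have formE (v : 'I_(1 + n * 2) -> U) :
    alpha_dalpha n V x (fun i => vsval (v i)) =
    c * altsum (tensor (form1 al) (tensor_pow (form2 w) n)) v.
  rewrite /alpha_dalpha -/(form2 (dform1 (alpha V) x)) powE.
  rewrite wedgeZr wedge_altsum.
  rewrite (_ : 1`!%:R = 1 :> R) // invr1 mul1r; congr (_ * _).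
  apply: eq_bigr => s _.
  rewrite /tensor (tensor_pow_comp vsval).
  rewrite (_ : (fun u => form2 _ _) = form2 w) //.
  by apply/funext => u; rewrite /form2 (dform1_alphaE lc vV xS) ?subvsP.
have [alg1 alg2] :=
  altsum_neq0_iff_nondegenerate al_lin wl wN dimU (ex_intro _ r r0).
split=> [[v [vT v0]] b|nd].
  rewrite mem_perp => /andP[bT /eqP Vb] bnd.
  suff z : vsproj (tangent x) b = 0 by rewrite -(vsprojK bT) z linear0.
  apply: alg1.
  - exists (fun i => vsproj (tangent x) (v i)); apply: contraNneq v0 => f0.
    rewrite (_ : v = fun i => vsval (vsproj (tangent x) (v i))).
      by rewrite formE f0 mulr0.
    by apply/funext => i; rewrite vsprojK.
  - by rewrite /al vsprojK.
  move=> d ald; rewrite /w vsprojK //; apply: bnd.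
  by rewrite mem_perp subvsP; apply/eqP.
have [|v v0] := alg2.
  move=> b alb wb; apply: subvs_inj; rewrite linear0; apply: nd => [|d].
    by rewrite mem_perp subvsP; apply/eqP.
  rewrite mem_perp => /andP[dT /eqP Vd].
  by have := wb (vsproj _ d); rewrite /w /al vsprojK //; exact.
exists (fun i => vsval (v i)).
by split=> [i|]; rewrite ?subvsP // formE mulf_neq0.
Qed.

Lemma twistingE (b : subvs_of (perp V x)) :
  vsval (twisting nabla V x b) = nabla V x (vsval b).
Proof.
have inT (c : subvs_of (perp V x)) : vsval c \in tangent x.
  exact: subvP (capvSl _ _) _ (subvsP c).
have inP (c : subvs_of (perp V x)) : nabla V x (vsval c) \in perp V x.
  exact: nabla_perp.
pose g (c : subvs_of (perp V x)) := vsproj (perp V x) (nabla V x (vsval c)).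
have g_lin : linear g.
  move=> a c d; apply: subvs_inj; rewrite [RHS]linearP /= /g !vsprojK //.
  by rewrite linearP (lc_linear lc) //; exact: inT.
pose gM := GRing.isLinear.Build _ _ _ _ g g_lin.
pose gL : {linear _ -> _} := HB.pack g gM.
by rewrite /twisting (lfunE gL) /= /g vsprojK.
Qed.

Lemma skew_twisting_nondegenerate :
  (lker (twisting nabla V x - transpose (twisting nabla V x)) == 0%VS) <->
  (forall b, b \in perp V x ->
     (forall c, c \in perp V x -> dalpha b c = 0) -> b = 0).
Proof.
rewrite lker_skew_eq0; split=> [inj b bP bnd|nd b bnd].
  suff z : vsproj (perp V x) b = 0 by rewrite -(vsprojK bP) z linear0.
  by apply: inj => c; rewrite !twistingE vsprojK //; apply: bnd; exact: subvsP.
apply: subvs_inj; rewrite linear0; apply: nd => [|c cP]; first exact: subvsP.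
by have := bnd (vsproj _ c); rewrite !twistingE vsprojK.
Qed.

End Pointwise.

Theorem proposition2 (R : realType) (n : nat) (M : topologicalType)
    (A : set (chart R (2 * n) M))
    (p : 'rV[R]_(2 * n).+2 -> M)
    (V : 'rV[R]_(2 * n).+2 -> 'rV[R]_(2 * n).+2)
    (nabla : ('rV[R]_(2 * n).+2 -> 'rV[R]_(2 * n).+2) ->
             'rV[R]_(2 * n).+2 -> 'rV[R]_(2 * n).+2 -> 'rV[R]_(2 * n).+2)
    (hn : (1 <= n)%N)
    (hF : oriented_great_circle_fibration A p V)
    (hnabla : levi_civita nabla) :
  contact_structure V <->
  (forall x, sphere R (2 * n).+2 x ->
     lker (twisting nabla V x - transpose (twisting nabla V x)) == 0%VS).
Proof.
have pointwise x (xS : sphere R (2 * n).+2 x) := conj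
  (contact_at_nondegenerate (ogf_field hF) (ogf_unit hF) hnabla xS)
  (skew_twisting_nondegenerate (ogf_field hF) (ogf_unit hF) hnabla xS).
split=> h x xS; have [[h1 h2] [h3 h4]] := pointwise x xS.
  exact: h4 (h1 (h x xS)).
exact: h2 (h3 (h x xS)).
Qed.
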